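(* Let $w=(w(n))_{n\ge 0}$ be a nondecreasing sequence of positive real numbers satisfying $\sum_{n=0}^\infty\frac1{w(n)}=\infty$. Consider the two conditions $$\text{(a)}\quad \limsup_{n\to\infty}\frac{W^{-1}(W(n)+\alpha)}{n}<\infty\ \text{ for every }\alpha>0;\qquad \text{(b)}\quad \limsup_{n\to\infty}\frac{w(cn)}{w(n)}<\infty\ \text{ for every }c>1 .$$ If both (a) and (b) hold, then $\beta_c(w)=\widetilde\beta_c(w)\in\{-\infty,\infty\}$. Moreover, if $w(n)=\mathcal{O}(n)$ as $n\to\infty$, then (a) holds.
   Context: Extend $w$ to $[0,\infty)$ by $w(t):=w(\lfloor t\rfloor)$ and set $W(t):=\int_0^t\frac{du}{w(u)}$. Since $\sum 1/w(n)=\infty$, $W$ is a bijection of $[0,\infty)$ onto itself; let $W^{-1}$ be its inverse, with the convention $W^{-1}(u)=0$ for $u<0$. For $\beta\in\mathbb{R}$ define $$J_\beta(w):=\int_0^\infty\frac{dx}{w\big(W^{-1}(2W(x)+\beta)\big)},\qquad \beta_c(w):=\inf\{\beta\in\mathbb{R}: J_\beta(w)<\infty\}\in[-\infty,+\infty].$$ Let $H(x):=x+W^{-1}(W(x)+1)$ for $x\ge0$; $H$ is increasing and continuous, and $H^{-1}$ denotes its inverse, defined on $[H(0),\infty)$, with the convention $H^{-1}(y)=0$ for $0\le y<H(0)$. For $\beta\in\mathbb{R}$ define $$\widetilde J_\beta(w):=\int_0^\infty\frac{dx}{w\big(H^{-1}(W^{-1}(2W(x)+\beta))\big)},\qquad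 \widetilde\beta_c(w):=\inf\{\beta\in\mathbb{R}:\widetilde J_\beta(w)<\infty\}\in[-\infty,+\infty].$$ In both cases $\inf\emptyset=+\infty$. *)

(* Defs.v *)
From HB Require Import structures.
From mathcomp Require Import all_boot all_order all_algebra.
From mathcomp Require Import all_classical all_reals all_analysis.
Import Order.TTheory GRing.Theory Num.Theory.
Import numFieldNormedType.Exports.

Set Implicit Arguments.
Unset Strict Implicit.
Unset Printing Implicit Defensive.

Local Open Scope classical_set_scope.
Local Open Scope ring_scope.

(* [Num.truncn t] is the floor of t when 0 <= t. It is 0 for t < 0, a case
   that never matters below: every argument of [wext] is nonnegative. *)
Definition wext (R : realType) (w : nat -> R) (t : R) : R := w (Num.truncn t).

Definition W (R : realType) (w : nat -> R) (t : R) : R :=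
  Rintegral lebesgue_measure `[0, t] (fun u : R => (wext w u)^-1).

(* The partial inverse ['pinv_(fun=> 0) A f] is 0 outside the image of A by f,
   which yields both conventions: Winv w u = 0 for u < 0, and Hinv w y = 0
   for y < H w 0. *)
Definition Winv (R : realType) (w : nat -> R) : R -> R :=
  'pinv_(fun=> 0) `[0, +oo[ (W w).

Definition H (R : realType) (w : nat -> R) (x : R) : R :=
  x + Winv w (W w x + 1).

Definition Hinv (R : realType) (w : nat -> R) : R -> R :=
  'pinv_(fun=> 0) `[0, +oo[ (H w).

Definition J (R : realType) (w : nat -> R) (beta : R) : \bar R :=
  (\int[lebesgue_measure]_(x in `[0%R, +oo[)
     ((wext w (Winv w (2 * W w x + beta)))^-1)%:E)%E.

Definition Jtilde (R : realType) (w : nat -> R) (beta : R) : \bar R :=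
  (\int[lebesgue_measure]_(x in `[0%R, +oo[)
     ((wext w (Hinv w (Winv w (2 * W w x + beta))))^-1)%:E)%E.

Definition beta_c (R : realType) (w : nat -> R) : \bar R :=
  ereal_inf [set beta%:E | beta in [set beta : R | (J w beta < +oo)%E]].

Definition betatilde_c (R : realType) (w : nat -> R) : \bar R :=
  ereal_inf [set beta%:E | beta in [set beta : R | (Jtilde w beta < +oo)%E]].

(* The term n = 0 is a division by 0 (equal to 0 in MathComp); the limit
   superior does not depend on it. *)
Definition cond_a (R : realType) (w : nat -> R) : Prop :=
  forall alpha : R, 0 < alpha ->
    (limn_esup (fun n : nat => (Winv w (W w n%:R + alpha) / n%:R)%:E) < +oo)%E.

Definition cond_b (R : realType) (w : nat -> R) : Prop :=
  forall c : R, 1 < c ->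
    (limn_esup (fun n : nat => (wext w (c * n%:R) / w n)%:E) < +oo)%E.

(* Main.v *)
Require Import Defs.
From mathcomp Require Import all_boot all_order all_algebra.
From mathcomp Require Import all_classical all_reals all_analysis.
From mathcomp Require Import measurable_realfun.
From mathcomp Require Import ring lra.
Import Order.TTheory GRing.Theory Num.Theory.
Import numFieldNormedType.Exports.
Local Open Scope classical_set_scope.
Local Open Scope ring_scope.

(** The sequence w is extended to a nondecreasing step function f, and
W' = 1/f, so V := W^-1 satisfies V' = f o V.

Why the critical value is infinite.  Replacing beta by beta + alpha replaces
y := V(2W(x) + beta) by V(W(y) + alpha).  By (a) this is at most C y once y is
large, so by (b) f grows by at most a constant factor between the two.  Hence
the integrands of J_beta and J_(beta + alpha) are comparable for large x
[J_finite_shift]: J_beta is finite either for every beta or for none, and the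
infimum is -oo or +oo [beta_c_infinite].

Why both critical values agree.  Always x <= H(x), and (a) with alpha = 1 gives
H(x) <= C x for large x [H_linear]; so H^-1(y) lies between y / C and y, and (b)
makes f(H^-1(y)) and f(y) comparable.  J_beta and Jtilde_beta are therefore
finite for the same beta [J_Jtilde_finite].

Both comparisons go through [integral_wextV_finite]: the part of the integral
over a bounded interval is finite because 1/f <= 1/f(0).

Why w(n) = O(n) implies (a).  If f(t) <= k t for large t, then
W(2t) - W(t) >= t / f(2t) >= 1 / (2k), so m doublings raise W by at least
m / (2k); with m >= 2 k alpha one gets V(W(n) + alpha) <= 2^m n [bigO_cond_a].

What is used of W is the pair of bounds
(y - x) / f(y) <= W(y) - W(x) <= (y - x) / f(x) [W_increment].  They make W,
and then H, strictly increasing and locally Lipschitz, hence bijections onto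
a half-line, so that the partial inverses of the definitions are genuine
monotone inverses. *)

(** * Inverses of increasing functions on the half-line *)

Lemma pinv_notin_image (T U : Type) (dflt : U -> T) (A : set T) (f : T -> U) y :
  ~ (f @` A) y -> 'pinv_dflt A f y = dflt y.
Proof.
move=> fAy; rewrite /pinv_ splitV.
rewrite (_ : 'oinv_[fun f in A] y = None)//.
(* the partial inverse chooses a preimage for the points of f @` A only *)
pose s : set_surj A (f @` A) f := fun _ => id.
by rewrite -[LHS]/('oinv_s y) oinv_surj; case: pselect.
Qed.

(** The intermediate value theorem on [0, M], for M with y <= f M.  The
one-sided increment bound is the form in which both W and H are controlled. *)
Lemma locally_lipschitz_onto (R : realType) (f : R -> R)
    (f_homo : forall x y : R, 0 <= x -> x <= y -> f x <= f y)
    (f_lip : forall M : R, 0 <= M -> exists2 L : R, 0 < L &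
       forall x y : R, 0 <= x -> x <= y -> y <= M -> f y - f x <= L * (y - x))
    (f_unbounded : forall B, exists2 x : R, 0 <= x & B <= f x) y :
  f 0 <= y -> exists2 x, 0 <= x & f x = y.
Proof.
move=> f0y; have [M M0 yM] := f_unbounded y; have [L L0 fL] := f_lip M M0.
have fL_norm x z : 0 <= x <= M -> 0 <= z <= M -> `|f x - f z| <= L * `|x - z|.
  wlog xz : x z / x <= z => [sym|/andP[x0 _] /andP[_ zM]].
    have [/sym//|/ltW/sym zx xM zM] := leP x z.
    by rewrite distrC [in leRHS]distrC zx.
  by rewrite !(distrC _ z, distrC _ (f z)) !ger0_norm ?subr_ge0 ?f_homo ?fL.
have [||x] := IVT (f := f) (v := y) M0.
- apply/subspace_continuousP => x /=; rewrite in_itv/= => xM.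
  apply/cvgrPdist_lt => e e0; rewrite near_withinE.
  apply/nbhs_ballP; exists (e / L) => /=; first by rewrite divr_gt0.
  move=> z /=; rewrite /ball/= in_itv/= ltr_pdivlMr// mulrC => xz zM.
  exact: le_lt_trans (fL_norm _ _ xM zM) xz.
- by rewrite minEle maxEle (f_homo 0 M)// f0y.
- by rewrite in_itv/= => /andP[x0 _] fx; exists x.
Qed.

Section monotone_inverse.
Context (R : realType) (f : R -> R).
Context (f_incr : forall x y, 0 <= x -> x < y -> f x < f y).
Context (f_onto : forall y, f 0 <= y -> exists2 x, 0 <= x & f x = y).
Let g : R -> R := 'pinv_(fun=> 0) `[0, +oo[ f.

Lemma pinv_increasing_out y : y < f 0 -> g y = 0.
Proof.
move=> yf0; apply: pinv_notin_image => -[x/=].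
rewrite in_itv/= andbT le_eqVlt => /orP[/eqP<-|x0] fx.
- by rewrite fx ltxx in yf0.
- by have := lt_trans yf0 (f_incr _ _ (lexx 0) x0); rewrite fx ltxx.
Qed.

Lemma pinv_increasingK x : 0 <= x -> g (f x) = x.
Proof.
move=> x0; apply: pinvKV; last by rewrite inE/= in_itv/= x0.
move=> {x0}x y; rewrite !inE/= !in_itv/= !andbT => x0 y0 fxy.
have [xy|yx|//] := ltgtP x y.
- by have := f_incr _ _ x0 xy; rewrite fxy ltxx.
- by have := f_incr _ _ y0 yx; rewrite fxy ltxx.
Qed.

Lemma pinv_increasing_ge0 y : 0 <= g y.
Proof.
have [/f_onto[x x0 <-]|/pinv_increasing_out->//] := leP (f 0) y.
by rewrite pinv_increasingK.
Qed.

Lemma pinv_increasingV y : f 0 <= y -> f (g y) = y.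
Proof. by move=> /f_onto[x x0 <-]; rewrite pinv_increasingK. Qed.

(** Monotonicity holds on the whole line: below f 0 the inverse takes the
default value 0, which is also its least value. *)
Lemma pinv_increasing_homo : {homo g : x y / x <= y}.
Proof.
move=> x y xy; have [fx|/pinv_increasing_out->] := leP (f 0) x; last first.
  exact: pinv_increasing_ge0.
rewrite leNgt; apply/negP => /(f_incr _ _ (pinv_increasing_ge0 _)).
by rewrite !pinv_increasingV ?(le_trans fx xy)// ltNge xy.
Qed.

End monotone_inverse.

Section nondecreasing_weight.
Context (R : realType) (w : nat -> R).
Context (w_gt0 : forall n : nat, 0 < w n).
Context (w_homo : {homo w : m n / (m <= n)%N >-> m <= n}).
Context (sum_w_inv : (\sum_(0 <= n <oo) ((w n)^-1)%:E = +oo)%E).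

(** * The function W and its inverse *)

Lemma wext_gt0 t : 0 < wext w t. Proof. exact: w_gt0. Qed.

Lemma wext_nat n : wext w n%:R = w n. Proof. by rewrite /wext natrK. Qed.

Lemma wext_homo : {homo wext w : x y / x <= y}.
Proof. by move=> x y xy; apply/w_homo/le_truncn. Qed.

Lemma wextV_homo x y : x <= y -> (wext w y)^-1 <= (wext w x)^-1.
Proof. by move=> xy; rewrite lef_pV2 ?posrE ?wext_gt0// wext_homo. Qed.

Lemma integrable_wextV (a b : itv_bound R) (y : R) :
  (BLeft 0 <= a)%O -> (b <= BRight y)%O ->
  (@lebesgue_measure R).-integrable [set` Interval a b]
    (EFin \o (fun u => (wext w u)^-1)).
Proof.
move=> a0 b1.
have base : (@lebesgue_measure R).-integrable `[0, y]
    (EFin \o (fun u => (wext w u)^-1)).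
  apply: measurable_bounded_integrable => //.
  - by rewrite /= lebesgue_measure_itv/= lte_fin; case: ifP; rewrite ?ltey.
  - by apply: nonincreasing_measurable => //= u v; exact: wextV_homo.
  - exists (wext w 0)^-1; split; rewrite ?num_real// => z zw u /=.
    rewrite in_itv/= => /andP[u0 _].
    rewrite ger0_norm ?invr_ge0 ?(ltW (wext_gt0 _))//.
    exact: le_trans (wextV_homo _ _ u0) (ltW zw).
by apply: integrableS base => //; exact: subset_itv.
Qed.

(** On ]x, y] the integrand 1/w lies between its values at y and at x. *)
Lemma W_increment x y : 0 <= x -> x <= y ->
  (y - x) / wext w y <= W w y - W w x <= (y - x) / wext w x.
Proof.
move=> x0 xy; rewrite /W Rintegral_itvB ?bnd_simp//; last first.
  exact: (integrable_wextV _ _ y).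
have cst_int c : (\int[lebesgue_measure]_(u in `]x, y]) c)%R = (y - x) * c.
  rewrite Rintegral_cst//= lebesgue_measure_itv/= lte_fin mulrC.
  case: ltP => [|yx]; first by rewrite -EFinB.
  by rewrite (le_anti (introT andP (conj xy yx))) subrr mul0r.
have ci c : (@lebesgue_measure R).-integrable `]x, y] (EFin \o cst c).
  have : (@lebesgue_measure R).-integrable `[x, y] (EFin \o cst c).
    apply: continuous_compact_integrable; first exact: segment_compact.
    by apply: continuous_subspaceT => z; exact: cvg_cst.
  by move=> cxy; apply: integrableS cxy => //; exact: subset_itv_oc_cc.
have wi := integrable_wextV (BRight x) (BRight y) y x0 (lexx _).
apply/andP; split.
- rewrite -cst_int; apply: le_Rintegral; [by []|exact: ci|exact: wi|].
  move=> u /=; rewrite in_itv/= => /andP[_ uy].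
  exact: wextV_homo.
- rewrite -cst_int; apply: le_Rintegral; [by []|exact: wi|exact: ci|].
  move=> u /=; rewrite in_itv/= => /andP[xu _].
  exact/wextV_homo/ltW.
Qed.

Lemma W0 : W w 0 = 0.
Proof. by rewrite /W set_itv1 Rintegral_set1. Qed.

Lemma W_lt x y : 0 <= x -> x < y -> W w x < W w y.
Proof.
move=> x0 xy; have /andP[+ _] := W_increment _ _ x0 (ltW xy).
rewrite -[W w x < _]subr_gt0; apply: lt_le_trans.
by rewrite divr_gt0 ?subr_gt0 ?wext_gt0.
Qed.

(** W vanishes on the negative numbers, where it is an integral over an empty
interval, so it is monotone on the whole line; the measurability of the
integrands of J and Jtilde rests on this. *)
Lemma W_homo : {homo W w : x y / x <= y}.
Proof.
move=> x y xy; have [x0|x0] := leP 0 x.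
  by move: xy; rewrite le_eqVlt => /orP[/eqP->//|/(W_lt _ _ x0)/ltW].
rewrite {1}/W set_itv_ge ?Rintegral_set0; last by rewrite bnd_simp -ltNge.
have [y0|y0] := ltP y 0.
  by rewrite {1}/W set_itv_ge ?Rintegral_set0// bnd_simp -ltNge.
move: y0; rewrite le_eqVlt => /orP[/eqP<-|/(W_lt _ _ (lexx 0))/ltW].
  by rewrite W0.
by rewrite W0.
Qed.

(** The increment of W over [n, n + 1] dominates 1/w(n + 1), so the divergence
of the series forces W to be unbounded. *)
Lemma sum_le_W n : \sum_(0 <= k < n.+1) (w k)^-1 <= (w 0%N)^-1 + W w n%:R.
Proof.
elim: n => [|n IHn]; first by rewrite big_nat1 W0 addr0.
rewrite big_nat_recr//=.
have : (n%:R : R) <= n.+1%:R by rewrite ler_nat.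
move=> /(W_increment _ _ (ler0n _ _)) /andP[+ _].
rewrite wext_nat -natrB// subSnn mul1r.
lra.
Qed.

Lemma W_unbounded B : exists2 x, 0 <= x & B <= W w x.
Proof.
suff [n Bn] : exists n, (w 0%N)^-1 + B <= \sum_(0 <= k < n.+1) (w k)^-1.
  exists n%:R => //; have := sum_le_W n; lra.
apply: contrapT => /forallNP small.
have : (\sum_(0 <= n <oo) ((w n)^-1)%:E <= ((w 0%N)^-1 + B)%:E)%E.
  apply: lime_le.
    by apply: is_cvg_nneseries => n _ _; rewrite lee_fin invr_ge0 ltW.
  apply: nearW => -[|n]; rewrite sumEFin lee_fin.
    (* the empty partial sum is dominated by the sum of one term *)
    apply: contrapT => /negP.
    rewrite -ltNge big_nil; move: (small 0%N) => /negP.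
    rewrite -ltNge big_nat1 => + ?.
    by have := w_gt0 0%N; rewrite -invr_gt0; lra.
  by move: (small n) => /negP; rewrite -ltNge => /ltW.
by rewrite sum_w_inv leye_eq.
Qed.

Lemma W_onto y : W w 0 <= y -> exists2 x, 0 <= x & W w x = y.
Proof.
apply: locally_lipschitz_onto => [u v _|M M0|].
- exact: W_homo.
- exists (wext w 0)^-1; first by rewrite invr_gt0 wext_gt0.
  move=> u v u0 uv _; have /andP[_ /le_trans->//] := W_increment _ _ u0 uv.
  by rewrite mulrC ler_wpM2r ?subr_ge0// wextV_homo.
- exact: W_unbounded.
Qed.

Lemma Winv_ge0 u : 0 <= Winv w u.
Proof. exact: (pinv_increasing_ge0 _ _ W_lt W_onto). Qed.

Lemma WK x : 0 <= x -> Winv w (W w x) = x.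
Proof. exact: (pinv_increasingK _ _ W_lt). Qed.

Lemma WinvK u : 0 <= u -> W w (Winv w u) = u.
Proof. by move=> u0; apply: (pinv_increasingV _ _ W_lt W_onto); rewrite W0. Qed.

Lemma Winv_homo : {homo Winv w : u v / u <= v}.
Proof. exact: (pinv_increasing_homo _ _ W_lt W_onto). Qed.

Lemma W_ge0 x : 0 <= x -> 0 <= W w x.
Proof. by move=> x0; rewrite -W0 W_homo. Qed.

(** For V := W^-1, the bound V' = w o V <= w (V v) on [u, v], read off from the
lower bound on the increments of W. *)
Lemma Winv_increment u v : 0 <= u -> u <= v ->
  Winv w v - Winv w u <= wext w (Winv w v) * (v - u).
Proof.
move=> u0 uv; have := W_increment _ _ (Winv_ge0 u) (Winv_homo _ _ uv).
rewrite !WinvK ?(le_trans u0)// => /andP[+ _].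
by rewrite ler_pdivrMr ?wext_gt0// mulrC.
Qed.

(** * The function H and its inverse *)

Lemma H_lt x y : 0 <= x -> x < y -> H w x < H w y.
Proof.
move=> x0 xy; rewrite /H ltr_leD// Winv_homo// lerD2r.
exact/W_homo/ltW.
Qed.

Lemma H_le x y : 0 <= x -> x <= y -> H w x <= H w y.
Proof.
by move=> x0; rewrite le_eqVlt => /orP[/eqP->//|/(H_lt _ _ x0)/ltW].
Qed.

Lemma H_ge x : 0 <= x -> x <= H w x.
Proof. by move=> x0; rewrite /H lerDl Winv_ge0. Qed.

Lemma H_onto y : H w 0 <= y -> exists2 x, 0 <= x & H w x = y.
Proof.
apply: locally_lipschitz_onto => [u v u0|M M0|B].
- exact: H_le.
- exists (1 + wext w (Winv w (W w M + 1)) / wext w 0).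
    by rewrite addr_gt0// divr_gt0 ?wext_gt0.
  move=> u v u0 uv vM.
  rewrite /H opprD addrACA mulrDl mul1r lerD2l.
  have W1 : W w u + 1 <= W w v + 1 by rewrite lerD2r W_homo.
  apply: (le_trans (Winv_increment _ _ _ W1)).
    by rewrite addr_ge0// W_ge0.
  rewrite opprD addrACA subrr addr0 -mulrA.
  rewrite ler_pM ?subr_ge0 ?(ltW (wext_gt0 _)) ?W_homo//.
    by apply/wext_homo/Winv_homo; rewrite lerD2r W_homo.
  have /andP[_ /le_trans->//] := W_increment _ _ u0 uv.
  by rewrite mulrC ler_wpM2r ?subr_ge0// wextV_homo.
- exists (Num.max 0 B); first by rewrite le_max lexx.
  by rewrite (le_trans _ (H_ge _ _))// le_max lexx ?orbT.
Qed.

Lemma Hinv_ge0 u : 0 <= Hinv w u.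
Proof. exact: (pinv_increasing_ge0 _ _ H_lt H_onto). Qed.

Lemma HinvK u : H w 0 <= u -> H w (Hinv w u) = u.
Proof. exact: (pinv_increasingV _ _ H_lt H_onto). Qed.

Lemma Hinv_homo : {homo Hinv w : u v / u <= v}.
Proof. exact: (pinv_increasing_homo _ _ H_lt H_onto). Qed.

Lemma Hinv_le u : 0 <= u -> Hinv w u <= u.
Proof.
move=> u0; have [Hu|Hu] := leP (H w 0) u; last first.
  by rewrite /Hinv (pinv_increasing_out _ _ H_lt).
by rewrite -[leRHS]HinvK// H_ge// Hinv_ge0.
Qed.

(** * Growth conditions at real arguments *)

Lemma limn_esup_ltyP (u : nat -> R) :
  (limn_esup (fun n => (u n)%:E) < +oo)%E <->
  exists (C : R) (N : nat), forall n, (N <= n)%N -> u n <= C.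
Proof.
split.
- rewrite /limn_esup limf_esupE => /ereal_inf_lt[_ [A [N _ NA] <-] supA].
  exists (fine (ereal_sup [set (u n)%:E | n in A])), N => n Nn.
  have un : ((u n)%:E <= ereal_sup [set (u n)%:E | n in A])%E.
    by apply: ereal_sup_ubound; exists n => //; exact: NA.
  rewrite -lee_fin fineK// fin_real// supA andbT.
  exact: lt_le_trans (ltNyr _) un.
- move=> [C [N uC]]; apply: (@le_lt_trans _ _ C%:E); last exact: ltry.
  rewrite /limn_esup limf_esupE.
  apply: (@le_trans _ _ (ereal_sup [set (u n)%:E | n in [set n | (N <= n)%N]])).
    by apply: ereal_inf_lbound; exists [set n | (N <= n)%N] => //; exists N.
  by apply: ub_ereal_sup => _ [n /= Nn <-]; rewrite lee_fin uC.
Qed.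

(** For n := floor x, monotonicity bounds the left-hand side by its value at
n + 1, and n + 1 <= 2 x as soon as n >= 1. *)
Lemma cond_a_eventually : cond_a w -> forall alpha, 0 < alpha ->
  exists C X : R, [/\ 0 < C, 0 <= X &
    forall x, X <= x -> Winv w (W w x + alpha) <= C * x].
Proof.
move=> wa alpha /wa /limn_esup_ltyP[C [N CN]].
exists (Num.max 1 C * 2), N.+1%:R; split => // [|x Nx].
  by rewrite mulr_gt0// lt_max ltr01.
have x0 : 0 <= x by apply: le_trans Nx.
have /andP[nx xn] := truncn_itv x0; set n := Num.truncn x in nx xn.
have Nn : (N.+1 <= n)%N by rewrite truncn_ge_nat.
have n0 : (0 : R) < n%:R by rewrite ltr0n (leq_trans _ Nn).
have := CN _ (leqW (ltnW Nn)); rewrite ler_pdivrMr ?ltr0n// => VC.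
apply: (@le_trans _ _ (Winv w (W w n.+1%:R + alpha))).
  by apply/Winv_homo; rewrite lerD2r W_homo// ltW.
rewrite (le_trans VC)// (@le_trans _ _ (Num.max 1 C * n.+1%:R))//.
  by rewrite ler_wpM2r// le_max lexx orbT.
rewrite -mulrA ler_wpM2l ?le_max ?ler01//.
have : (1 : R) <= n%:R by rewrite ler1n -(ltr0n R).
by rewrite -natr1; lra.
Qed.

(** For n := floor x one has w x = w n and, when n >= 1, c x <= 2 c n; so the
condition is applied to the factor 2 c. *)
Lemma cond_b_eventually : cond_b w -> forall c, 1 < c ->
  exists K X : R, [/\ 0 < K, 0 <= X &
    forall x, X <= x -> wext w (c * x) <= K * wext w x].
Proof.
move=> wb c c1; have c2 : 1 < c * 2 by lra.
have /limn_esup_ltyP[K [N KN]] := wb _ c2.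
exists (Num.max 1 K), N.+1%:R; split => // [|x Nx].
  by rewrite lt_max ltr01.
have x0 : 0 <= x by apply: le_trans Nx.
have /andP[nx xn] := truncn_itv x0.
have Nn : (N.+1 <= Num.truncn x)%N by rewrite truncn_ge_nat.
rewrite {2}/wext; set n := Num.truncn x in nx xn Nn *.
have n0 : (1 : R) <= n%:R by rewrite ler1n (leq_trans _ Nn).
have := KN _ (ltnW Nn); rewrite ler_pdivrMr// => wK.
apply: (@le_trans _ _ (wext w (c * 2 * n%:R))).
  apply: wext_homo; rewrite -mulrA ler_wpM2l//; first by lra.
  by rewrite -natr1 in xn; lra.
by rewrite (le_trans wK)// ler_wpM2r ?(ltW (w_gt0 _))// le_max lexx orbT.
Qed.

(** * Comparison of the integrals *)

(** Below X the integrand is at most 1 / w 0, beyond X it is at most K times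
the other one; monotonicity of p and q serves measurability. *)
Lemma integral_wextV_finite (p q : R -> R) (K X : R) :
    {homo p : x y / x <= y} -> {homo q : x y / x <= y} ->
    (forall x, 0 <= p x) ->
    0 < K -> 0 <= X ->
    (forall x, X <= x -> wext w (q x) <= K * wext w (p x)) ->
  (\int[lebesgue_measure]_(x in `[0%R, +oo[) ((wext w (q x))^-1)%:E < +oo)%E ->
  (\int[lebesgue_measure]_(x in `[0%R, +oo[) ((wext w (p x))^-1)%:E < +oo)%E.
Proof.
move=> p_homo q_homo p0 K0 X0 qp q_fin.
have wV0 t : (0 <= ((wext w t)^-1)%:E)%E.
  by rewrite lee_fin invr_ge0 ltW// wext_gt0.
have mV (r : R -> R) (D : set R) : measurable D -> {homo r : x y / x <= y} ->
    measurable_fun D (fun x => ((wext w (r x))^-1)%:E).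
  move=> mD r_homo; apply/measurable_EFinP.
  apply: nonincreasing_measurable => // x y xy.
  exact/wextV_homo/r_homo.
have -> : `[0, +oo[%classic = `[0, X[%classic `|` `[X, +oo[%classic.
  by rewrite -itv_bndbnd_setU ?bnd_simp.
rewrite ge0_integral_setU//=; last 2 first.
- by apply: mV p_homo; exact: measurableU.
- apply/disj_setPS => u /=; rewrite !in_itv/= andbT => -[/andP[_ uX] Xu].
  by rewrite ltNge Xu in uX.
apply: lte_add_pinfty.
- apply: (@le_lt_trans _ _ (\int[lebesgue_measure]_(x in `[0%R, X[)
    (cst ((wext w 0)^-1)%:E x))%E).
    apply: ge0_le_integral => //=; [exact: mV|].
    by move=> x _; rewrite lee_fin wextV_homo.
  rewrite integral_cst//= lebesgue_measure_itv/=.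
  by case: ifP; rewrite ?mule0// -EFinB -EFinM ltry.
- apply: (@le_lt_trans _ _ (\int[lebesgue_measure]_(x in `[X, +oo[)
    (K%:E * ((wext w (q x))^-1)%:E))%E).
    apply: ge0_le_integral => //=.
    + exact: mV.
    + exact: measurable_funeM (mV _ _ _ q_homo).
    + move=> x; rewrite in_itv/= andbT => Xx; rewrite -EFinM lee_fin.
      rewrite -ler_pdivrMl// -invfM lef_pV2 ?posrE ?mulr_gt0 ?wext_gt0//.
      exact: qp.
  rewrite ge0_integralZl//=; [|exact: mV|by rewrite lee_fin ltW].
  rewrite lte_mul_pinfty ?lee_fin ?(ltW K0)//.
  apply: le_lt_trans q_fin; apply: ge0_subset_integral => //=; first exact: mV.
  by apply: subset_itvr; rewrite bnd_simp.
Qed.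

Definition J_argument (beta x : R) : R := Winv w (2 * W w x + beta).

Lemma J_argument_homo beta : {homo J_argument beta : x y / x <= y}.
Proof.
by move=> x y xy; apply: Winv_homo; rewrite lerD2r ler_pM2l// W_homo.
Qed.

Lemma J_argument_large beta Y : 0 <= Y -> exists2 X, 0 <= X &
  forall x, X <= x -> 0 <= 2 * W w x + beta /\ Y <= J_argument beta x.
Proof.
move=> Y0; have [X X0 BX] := W_unbounded (W w Y + `|beta|).
exists X => // x Xx; have := W_homo _ _ Xx; have WY := W_ge0 _ Y0.
have := ler_norm (- beta); rewrite normrN => b1 WX.
have b0 := normr_ge0 beta.
have le_arg : W w Y <= 2 * W w x + beta by lra.
split; first exact: le_trans le_arg.
by rewrite -[leLHS]WK//; apply: Winv_homo.
Qed.

(** The case beta <= beta' is monotonicity.  Otherwise put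
y := J_argument beta' x and alpha := beta - beta': then, for large x,
J_argument beta x = W^-1(W(y) + alpha) <= C y. *)
Lemma J_finite_shift beta beta' : cond_a w -> cond_b w ->
  (J w beta < +oo -> J w beta' < +oo)%E.
Proof.
move=> wa wb.
have [le_b|lt_b] := leP beta beta'.
  apply: (integral_wextV_finite (J_argument beta') (J_argument beta) 1 0) => //;
    try exact: J_argument_homo.
  - by move=> x; exact: Winv_ge0.
  - by move=> x x0; rewrite mul1r; apply/wext_homo/Winv_homo; rewrite lerD2l.
have alpha0 : 0 < beta - beta' by rewrite subr_gt0.
have [C [Y [C0 Y0 VC]]] := cond_a_eventually wa _ alpha0.
(* 1 + C rather than C, since the factor has to exceed 1 *)
have [|K [Z [K0 Z0 wK]]] := cond_b_eventually wb (1 + C).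
  by rewrite ltrDl.
have YZ0 : 0 <= Num.max Y Z by rewrite le_max Y0.
have [X X0 XYZ] := J_argument_large beta' _ YZ0.
apply: (integral_wextV_finite (J_argument beta') (J_argument beta) K X) => //;
  try exact: J_argument_homo.
- by move=> x; exact: Winv_ge0.
- move=> x /XYZ[arg0]; rewrite ge_max => /andP[Yx Zx].
  apply: le_trans (wK _ Zx); apply: wext_homo.
  have := VC _ Yx; rewrite WinvK//.
  have -> : 2 * W w x + beta' + (beta - beta') = 2 * W w x + beta by ring.
  move=> /le_trans; apply; rewrite ler_wpM2r ?Winv_ge0//; lra.
Qed.

Lemma H_linear : cond_a w -> exists C X : R, [/\ 0 < C, 0 <= X &
  forall x, X <= x -> H w x <= C * x].
Proof.
move=> wa; have [C [X [C0 X0 VC]]] := cond_a_eventually wa _ ltr01.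
exists (1 + C), X; split => // [|x Xx]; first lra.
by rewrite /H mulrDl mul1r lerD2l VC.
Qed.

(** Since x <= H x, the argument of w in Jtilde is at most the one in J; since
H x <= C x for large x, it is eventually at least that one divided by C. *)
Lemma J_Jtilde_finite beta : cond_a w -> cond_b w ->
  (J w beta < +oo <-> Jtilde w beta < +oo)%E.
Proof.
move=> wa wb.
have arg_homo : {homo (fun x => Hinv w (J_argument beta x)) : x y / x <= y}.
  by move=> x y xy; apply/Hinv_homo/J_argument_homo.
split; last first.
  apply: (integral_wextV_finite (J_argument beta) _ 1 0) => //;
    try exact: J_argument_homo.
  - by move=> x; exact: Winv_ge0.
  - by move=> x _; rewrite mul1r; apply/wext_homo/Hinv_le/Winv_ge0.
have [C [Y [C0 Y0 HC]]] := H_linear wa.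
(* 1 + C rather than C, since the factor has to exceed 1 *)
have [|K [Z [K0 Z0 wK]]] := cond_b_eventually wb (1 + C).
  by rewrite ltrDl.
(* an argument beyond H (max Y Z) has its preimage under H beyond Y and Z *)
have HM0 : 0 <= H w (Num.max Y Z).
  by rewrite (le_trans _ (H_ge _ _))// le_max Y0.
have [X X0 XYZ] := J_argument_large beta _ HM0.
apply: (integral_wextV_finite _ (J_argument beta) K X) => //;
  try exact: J_argument_homo.
  by move=> x; exact: Hinv_ge0.
move=> x /XYZ[_ le_arg].
have M0 : 0 <= Num.max Y Z by rewrite le_max Y0.
have HargK := HinvK _ (le_trans (H_le _ _ (lexx 0) M0) le_arg).
have : Num.max Y Z <= Hinv w (J_argument beta x).
  rewrite leNgt; apply/negP => /(H_lt _ _ (Hinv_ge0 _)).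
  by rewrite HargK ltNge le_arg.
rewrite ge_max => /andP[Yx Zx].
apply: le_trans (wK _ Zx); apply: wext_homo.
rewrite -{1}HargK (le_trans (HC _ Yx))// ler_wpM2r ?Hinv_ge0//; lra.
Qed.

Lemma beta_c_eq_betatilde_c : cond_a w -> cond_b w -> beta_c w = betatilde_c w.
Proof.
move=> wa wb; rewrite /beta_c /betatilde_c; congr (ereal_inf (_ @` _)).
by apply/seteqP; split => beta /=; apply (J_Jtilde_finite beta wa wb).
Qed.

Lemma beta_c_infinite : cond_a w -> cond_b w ->
  beta_c w = -oo%E \/ beta_c w = +oo%E.
Proof.
move=> wa wb; rewrite /beta_c.
have [[beta Jb]|/forallNP Jinf] := pselect (exists beta, (J w beta < +oo)%E).
- left; apply: eq_ninfty => A; apply: ereal_inf_lbound; exists A => //=.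
  exact: J_finite_shift Jb.
- right; rewrite -[RHS](ereal_inf0 R) -[in RHS](image_set0 EFin).
  congr (ereal_inf (_ @` _)).
  by rewrite -subset0 => beta; exact: Jinf.
Qed.

(** * Linear growth *)

(** Each doubling of x raises W by at least 1 / (2k). *)
Lemma bigO_cond_a : w =O_\oo (fun n : nat => n%:R : R) -> cond_a w.
Proof.
move=> /eqO_exP[k k0 [N _ wk]] alpha alpha0; apply/limn_esup_ltyP.
have wx x : N.+1%:R <= x -> wext w x <= k * x.
  move=> Nx; have x0 : 0 <= x by apply: le_trans Nx.
  have /andP[nx xn] := truncn_itv x0.
  have Nn : (N.+1 <= Num.truncn x)%N by rewrite truncn_ge_nat.
  have := wk _ (ltnW Nn); rewrite !ger0_norm ?ler0n ?(ltW (w_gt0 _))//.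
  by move=> /le_trans; apply; rewrite ler_wpM2l// ltW.
have W_double x : N.+1%:R <= x -> W w x + (2 * k)^-1 <= W w (2 * x).
  move=> Nx; have x0 : 0 < x by apply: lt_le_trans Nx; rewrite ltr0n.
  have x2 : x <= 2 * x by lra.
  have /andP[+ _] := W_increment _ _ (ltW x0) x2.
  rewrite lerBrDl; apply: le_trans; rewrite lerD2l.
  rewrite ler_pdivlMr ?wext_gt0// [leLHS]mulrC ler_pdivrMr ?mulr_gt0//.
  have := wx _ (le_trans Nx x2); lra.
have W_pow m x : N.+1%:R <= x -> W w x + m%:R / (2 * k) <= W w (2 ^+ m * x).
  move=> Nx; elim: m => [|m IHm]; first by rewrite mul0r addr0 expr0 mul1r.
  have /W_double : N.+1%:R <= 2 ^+ m * x.
    rewrite (le_trans Nx)// ler_peMl ?(le_trans _ Nx)//.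
    by rewrite exprn_ege1// ler1n.
  rewrite mulrA -exprS -[m.+1%:R]natr1 [_ / (2 * k)]mulrDl mul1r addrA.
  by apply: le_trans; rewrite lerD2r.
pose m := (Num.truncn (2 * k * alpha)).+1.
exists (2 ^+ m), N.+1 => n Nn.
have n0 : 0 < n%:R :> R by rewrite ltr0n (leq_ltn_trans _ Nn).
rewrite ler_pdivrMr// -[leRHS]WK; last by rewrite mulr_ge0 ?exprn_ge0// ltW.
apply: Winv_homo; apply: le_trans (W_pow m _ _); last by rewrite ler_nat.
rewrite lerD2l ler_pdivlMr ?mulr_gt0// mulrC.
exact/ltW/truncnS_gt.
Qed.

End nondecreasing_weight.

Theorem lemma5p2 (R : realType) (w : nat -> R)
    (w_gt0 : forall n : nat, 0 < w n)
    (w_nondecreasing : {homo w : m n / (m <= n)%N >-> m <= n})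
    (sum_w_inv : (\sum_(0 <= n <oo) ((w n)^-1)%:E = +oo)%E) :
  (cond_a w -> cond_b w ->
     beta_c w = betatilde_c w /\
     (beta_c w = -oo%E \/ beta_c w = +oo%E)) /\
  (w =O_\oo (fun n : nat => n%:R : R) -> cond_a w).
Proof.
split; last exact: bigO_cond_a.
move=> wa wb; split; first exact: beta_c_eq_betatilde_c.
exact: beta_c_infinite.
Qed.
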